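(* Let $m$ be a positive integer. If $D$ is a quaternary near-extremal Hermitian self-dual code of length $6m$, then $A_{2i}(D) \equiv 0 \pmod 9$ for every $i = m, m+1, \ldots, 3m$, where $A_{j}(D)$ denotes the number of codewords of weight $j$ in $D$.
   Context: Let $\mathbb{F}_4=\{0,1,\omega,\omega^2\}$ with $\omega^2=\omega+1$. A quaternary code of length $n$ is a linear subspace of $\mathbb{F}_4^n$. The Hermitian inner product is $\langle x,y\rangle_H=\sum_{k=1}^n x_k y_k^2$, the Hermitian dual of $D$ is $D^{\perp_H}=\{x\in\mathbb{F}_4^n : \langle x,y\rangle_H=0 \text{ for all } y\in D\}$, and $D$ is Hermitian self-dual if $D=D^{\perp_H}$. The weight of a vector is the number of its nonzero coordinates, and the minimum weight is the smallest weight of a nonzero codeword. A quaternary Hermitian self-dual code of length $n$ is called near-extremal if its minimum weight equals $2\lfloor n/6\rfloor$; thus for length $6m$ the minimum weight is $2m$. *)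

(* Defs.v *)
From HB Require Import structures.
From mathcomp Require Import all_boot all_order all_algebra.
Set Implicit Arguments. Unset Strict Implicit. Unset Printing Implicit Defensive.
Import GRing.Theory.
Local Open Scope ring_scope.

(* Quaternary codes: F is an arbitrary finite field with 4 elements
   (unique up to isomorphism, i.e. F_4); vectors are row vectors 'rV[F]_n. *)

Definition herm_ip (F : finFieldType) (n : nat) (x y : 'rV[F]_n) : F :=
  \sum_(k < n) x ord0 k * (y ord0 k) ^+ 2.

Definition herm_self_dual (F : finFieldType) (n : nat) (D : {vspace 'rV[F]_n}) : Prop :=
  forall x : 'rV[F]_n, (x \in D) <-> (forall y : 'rV[F]_n, y \in D -> herm_ip x y = 0).

Definition wt (F : finFieldType) (n : nat) (x : 'rV[F]_n) : nat :=
  #|[set k : 'I_n | x ord0 k != 0]|.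

Definition has_min_weight (F : finFieldType) (n : nat) (D : {vspace 'rV[F]_n}) (d : nat) : Prop :=
  (exists2 x : 'rV[F]_n, (x \in D) && (x != 0) & wt x = d) /\
  (forall x : 'rV[F]_n, x \in D -> x != 0 -> (d <= wt x)%N).

Definition weight_count (F : finFieldType) (n : nat) (D : {vspace 'rV[F]_n}) (j : nat) : nat :=
  #|[set x : 'rV[F]_n | (x \in D) && (wt x == j)]|.

Definition near_extremal (F : finFieldType) (n : nat) (D : {vspace 'rV[F]_n}) : Prop :=
  herm_self_dual D /\ has_min_weight D (2 * (n %/ 6)).

(* Main.v *)
(* Let W(t) = sum_i A_i t^i. By the MacWilliams identity W is a form of degree 6m
   multiplied by 2^(6m) under (x, y) |-> (x + 3 y, x - y), and it is even. Such a form
   that is O(t^(2m+2)) is divisible by (t (1-t) (1+t))^(2m+2), so it vanishes; hence W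
   is determined by A_0, ..., A_2m.

   Comparing the words that are nonzero at coordinate k with those nonzero at l gives
   an odd form Z of degree 6m-2 with the same symmetry. It is divisible by
   (t (1-t) (1+t))^(2m-1) (1+3t), so Z = 0 and the number B of words of weight 2m that
   are nonzero at a given coordinate does not depend on the coordinate. Counting
   incidences, A_2m = 3 B, and 3 divides B by scaling, so 9 divides A_2m.

   Modulo 9 one has (1 + 3 t^2)^3 = 1, so expanding W in the monomials
   (1 + 3 t^2)^(3(m-j)) (t^2 (1-t^2)^2)^j, with A_0 = 1 and A_i = 0 mod 9 for
   0 < i <= 2m, gives W = 1 mod 9. *)
Require Import Defs.
From mathcomp Require Import all_boot all_order all_algebra all_field.
From mathcomp Require Import ring lra zify.
Set Implicit Arguments. Unset Strict Implicit. Unset Printing Implicit Defensive.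
Import Order.TTheory GRing.Theory Num.Theory.
Local Open Scope ring_scope.

(** * The trace character of F_4 and Poisson summation *)

(* (-1)^Tr(a), where Tr(a) = a + a^2 is the trace of F_4 over F_2. *)
Definition chi (F : finFieldType) (a : F) : rat := (-1) ^+ (a + a ^+ 2 != 0).

Lemma chi0 (F : finFieldType) : chi (0 : F) = 1.
Proof. by rewrite /chi expr0n addr0 eqxx. Qed.

Lemma pchar2_card4 (F : finFieldType) : #|F| = 4%N -> 2 \in [pchar F].
Proof. by move=> F4; apply: (@card_finPcharP _ _ 2). Qed.

Lemma chiD (F : finFieldType) (a b : F) :
  #|F| = 4%N -> chi (a + b) = chi a * chi b.
Proof.
move=> F4; have p2 := pchar2_card4 F4.
(* The trace lies in F_2, since Tr(x) (Tr(x) - 1) = x^4 - x = 0 in characteristic 2; this makes the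
   sign multiplicative. *)
have tr01 (x : F) : (x + x ^+ 2 == 0) || (x + x ^+ 2 == 1).
  rewrite -[_ == 1]subr_eq0 -mulf_eq0.
  have -> : (x + x ^+ 2) * (x + x ^+ 2 - 1) = x ^+ 4 - x + (x ^+ 3) *+ 2 by ring.
  by rewrite -[in x ^+ 4]F4 expf_card subrr add0r -mulr_natr pcharf0 ?mulr0.
have -> : chi (a + b) = (-1) ^+ ((a + a ^+ 2) + (b + b ^+ 2) != 0).
  rewrite /chi; congr (_ ^+ (_ != _)).
  have -> : a + b + (a + b) ^+ 2 = a + a ^+ 2 + (b + b ^+ 2) + (a * b) *+ 2 by ring.
  by rewrite -[X in _ + X]mulr_natr pcharf0 ?mulr0 ?addr0.
rewrite /chi; have nz1 : (1 : F) != 0 by exact: oner_neq0.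
case/orP: (tr01 a) => /eqP ->; case/orP: (tr01 b) => /eqP ->;
  rewrite ?addr0 ?add0r ?eqxx ?nz1 ?mul1r ?mulr1 //.
by rewrite -(natrD F 1 1) pcharf0 // eqxx /= mulrNN mulr1.
Qed.

Lemma chi_sum (F : finFieldType) (I : finType) (f : I -> F) :
  #|F| = 4%N -> chi (\sum_i f i) = \prod_i chi (f i).
Proof.
move=> F4; apply: (big_morph _ _ (chi0 F)) => x y; exact: chiD.
Qed.

(** In characteristic 2, Tr(b) = b (b - 1), so any b outside {0, 1} has nonzero trace. *)
Lemma chi_nontrivial (F : finFieldType) (c : F) :
  #|F| = 4%N -> c != 0 -> exists a, chi (a * c) = -1.
Proof.
move=> F4 c0; have p2 := pchar2_card4 F4.
have [b /andP [b0 b1]] : exists b : F, (b != 0) && (b != 1).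
  apply/existsP; apply: contraT => /existsPn h.
  have : (#|F| <= #|[set (0%R : F); 1%R]|)%N.
    rewrite -cardsT; apply/subset_leq_card/subsetP => x _.
    by rewrite !inE; move: (h x); rewrite negb_and !negbK.
  by rewrite F4 cards2; case: (_ != _).
exists (b / c); rewrite divfK // /chi.
suff -> : b + b ^+ 2 != 0 by [].
have -> : b + b ^+ 2 = b * (b - 1) + b *+ 2 by ring.
by rewrite -[b *+ 2]mulr_natr pcharf0 // mulr0 addr0 mulf_neq0 // subr_eq0.
Qed.

Lemma sum_chi_scale (F : finFieldType) (c : F) :
  #|F| = 4%N -> c != 0 -> \sum_a chi (a * c) = 0.
Proof.
move=> F4 c0; have [a0 ha] := chi_nontrivial F4 c0.
have : \sum_a chi (a * c) = - \sum_a chi (a * c).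
  rewrite [LHS](reindex (+%R a0)) /=; last by exists (+%R (- a0)) => x _; rewrite ?addKr ?addNKr.
  by rewrite -sumrN; apply: eq_bigr => x _; rewrite mulrDl chiD // ha mulN1r.
lra.
Qed.

Lemma herm_ipDr (F : finFieldType) n (v x y : 'rV[F]_n) :
  2 \in [pchar F] -> herm_ip v (x + y) = herm_ip v x + herm_ip v y.
Proof.
move=> p2; rewrite /herm_ip -big_split; apply: eq_bigr => k _ /=.
by rewrite mxE -mulrDr sqrrD -mulr_natr pcharf0 // mulr0 addr0.
Qed.

Lemma herm_ipZr (F : finFieldType) n (v x : 'rV[F]_n) (a : F) :
  herm_ip v (a *: x) = a ^+ 2 * herm_ip v x.
Proof.
rewrite /herm_ip mulr_sumr; apply: eq_bigr => k _ /=.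
by rewrite mxE; ring.
Qed.

(** Orthogonality of characters: if v is outside D, self-duality gives c in D not orthogonal to v,
    and translation by a suitable multiple of c negates the sum. *)
Lemma sum_chi_code (F : finFieldType) n (D : {vspace 'rV[F]_n}) (v : 'rV[F]_n) :
  #|F| = 4%N -> herm_self_dual D ->
  \sum_(c in D) chi (herm_ip v c) = (if v \in D then #|D|%:R else 0).
Proof.
move=> F4 sd; have p2 := pchar2_card4 F4; case: ifPn => vD.
  rewrite -sumr_const; apply: eq_bigr => c cD.
  by rewrite ((sd v).1 vD) // chi0.
have /existsP [c /andP [cD c0]] : [exists c, (c \in D) && (herm_ip v c != 0)].
  apply: contraT => /existsPn h; case/negP: vD; apply/sd => y yD.
  by move: (h y); rewrite yD /= negbK => /eqP.
have [b hb] := chi_nontrivial F4 c0.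
(* The form is semilinear in its second argument, so the scalar must be a square root of b; b^2 is
   one because b^4 = b. *)
pose a := b ^+ 2.
have a2 : a ^+ 2 = b by rewrite /a -exprM -[(2 * 2)%N]F4 expf_card.
have acD : a *: c \in D by exact: memvZ.
have : \sum_(c in D) chi (herm_ip v c) = - \sum_(c in D) chi (herm_ip v c).
  rewrite [LHS](reindex (+%R (a *: c))) /=; last first.
    by exists (+%R (- (a *: c))) => x _; rewrite ?addKr ?addNKr.
  rewrite -sumrN; apply: eq_big => [x|x _].
    by rewrite rpredDl.
  by rewrite herm_ipDr // herm_ipZr chiD // a2 hb mulN1r.
lra.
Qed.

(** Expanding the product over all vectors v and exchanging sums leaves the character sum of D at v,
    which is |D| or 0. Letting f depend on k makes it possible to single out one coordinate. *)
Lemma poisson (F : finFieldType) n (D : {vspace 'rV[F]_n}) (f : 'I_n -> F -> rat) :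
  #|F| = 4%N -> herm_self_dual D ->
  \sum_(c in D) \prod_k \sum_a f k a * chi (a * c ord0 k ^+ 2)
  = #|D|%:R * \sum_(v in D) \prod_k f k (v ord0 k).
Proof.
move=> F4 sd.
have distr (c : 'rV[F]_n) : \prod_k \sum_a f k a * chi (a * c ord0 k ^+ 2)
    = \sum_(v : 'rV[F]_n) (\prod_k f k (v ord0 k)) * chi (herm_ip v c).
  rewrite bigA_distr_bigA /= (reindex (fun v : 'rV[F]_n => [ffun k => v ord0 k])) /=.
    apply: eq_bigr => v _; rewrite /herm_ip chi_sum // -big_split.
    by apply: eq_bigr => k _; rewrite ffunE.
  exists (fun g : {ffun 'I_n -> F} => \row_k g k) => g _.
    by apply/rowP => k; rewrite !mxE ffunE.
  by apply/ffunP => k; rewrite ffunE mxE.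
under eq_bigr do rewrite distr.
rewrite exchange_big /= mulr_sumr [RHS]big_mkcond; apply: eq_bigr => v _.
by rewrite -mulr_sumr sum_chi_code //; case: ifP; rewrite ?mulr0 // mulrC.
Qed.

Lemma fourier_weight (F : finFieldType) (s : rat) (c : F) :
  #|F| = 4%N ->
  \sum_a (if a == 0 then 1 else s) * chi (a * c ^+ 2)
  = if c == 0 then 1 + 3 * s else 1 - s.
Proof.
move=> F4.
rewrite (bigD1 0) //= eqxx mul0r chi0 mul1r.
rewrite (eq_bigr (fun a => s * chi (a * c ^+ 2))) => [|a /negPf -> //].
rewrite -mulr_sumr; case: eqP => [->|/eqP c0].
  rewrite expr0n; under eq_bigr do rewrite mulr0 chi0.
  rewrite sumr_const.
  have -> : #|[pred i : F | i != 0]| = 3%N.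
    by transitivity #|predC1 (0 : F)|; [apply: eq_card | rewrite cardC1 F4].
  by rewrite mulrC.
have /eqP := sum_chi_scale F4 (expf_neq0 2 c0).
by rewrite (bigD1 0) //= mul0r chi0 addrC addr_eq0 => /eqP ->; rewrite mulrN1.
Qed.

Lemma fourier_delta (F : finFieldType) (c : F) :
  \sum_a (a == 0)%:R * chi (a * c ^+ 2) = 1.
Proof.
rewrite (bigD1 0) //= eqxx mul0r chi0 mul1r big1 ?addr0 // => a /negPf ->.
by rewrite mul0r.
Qed.

(** * Forms invariant under the MacWilliams transform *)

Lemma mul1D3_neq0 (s : rat) : 0 < s -> 1 + 3 * s != 0.
Proof. by move=> s0; apply: lt0r_neq0; rewrite addr_gt0 ?mulr_gt0. Qed.

(* A binary form of degree N that (x, y) |-> (x + 3 y, x - y) multiplies by c,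
   dehomogenised at x = 1; taking s > 0 avoids the pole -1/3. *)
Definition mac_inv (N : nat) (c : rat) (p : {poly rat}) : Prop :=
  forall s : rat, 0 < s ->
  (1 + 3 * s) ^+ N * p.[(1 - s) / (1 + 3 * s)] = c * p.[s].

Lemma poly_eq_pos (p q : {poly rat}) :
  (forall s, 0 < s -> p.[s] = q.[s]) -> p = q.
Proof.
move=> h; apply/eqP; rewrite -subr_eq0; apply/eqP.
pose rs := [seq (i.+1%:R : rat) | i <- iota 0 (size (p - q))].
apply/eqP; apply: contraTT (leqnn (size (p - q))) => pq0; rewrite -ltnNge.
have szrs : size rs = size (p - q) by rewrite size_map size_iota.
rewrite -{1}szrs.
apply: max_poly_roots => //.
  apply/allP => _ /mapP [i _ ->].
  by rewrite /root hornerD hornerN h ?subrr ?ltr0n.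
by rewrite map_inj_uniq ?iota_uniq // => i j /eqP; rewrite eqr_nat => /eqP [].
Qed.

(** With p = t^d q, the transform of p is the sum of q_i (1 - s)^(d+i) (1 + 3s)^(N-d-i); the bound
    on the size of p makes every exponent N-d-i at least e. *)
Lemma mac_inv_dvdp N (c : rat) p d e : c != 0 -> mac_inv N c p -> 'X^d %| p ->
  (size p + e <= N.+1)%N ->
  ((1 - 'X) ^+ d * (1 + 3 * 'X) ^+ e) %| p.
Proof.
move=> c0 inv /dvdpP [q pE] szp.
have [->|p0] := eqVneq p 0; first by rewrite dvdp0.
have q0 : q != 0 by apply: contraNneq p0 => q0; rewrite pE q0 mul0r.
have szq : (size q + d = size p)%N.
  by rewrite pE size_mul ?size_polyXn ?addnS // -size_poly_eq0 size_polyXn.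
pose X : {poly rat} := 1 + 3 * 'X; pose Y : {poly rat} := 1 - 'X.
pose r := \sum_(i < size q) q`_i *: (X ^+ (N - d - e - i) * Y ^+ i).
rewrite -(dvdpZr _ _ c0).
suff -> : c *: p = r * (Y ^+ d * X ^+ e) by rewrite dvdp_mull.
apply: poly_eq_pos => s s0; rewrite hornerZ -inv // {}pE.
have hX : X.[s] = 1 + 3 * s by rewrite /X !hornerE.
have hY : Y.[s] = 1 - s by rewrite /Y !hornerE.
rewrite !hornerM !horner_exp hX hY hornerX /r horner_sum horner_coef.
rewrite !mulr_suml mulr_sumr; apply: eq_bigr => i _.
rewrite hornerZ hornerM !horner_exp hX hY.
(* This bound keeps the natural subtraction in the exponent of [r] from truncating. *)
have hi : (i + d + e <= N)%N.
  by rewrite -ltnS (leq_trans _ szp) // -szq !ltn_add2r ltn_ord.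
have [j ->] : exists j, N = (j + i + d + e)%N by exists (N - (i + d + e))%N; lia.
have -> : (j + i + d + e - d - e - i = j)%N by lia.
have X0 := mul1D3_neq0 s0.
rewrite !exprMn !exprVn.
rewrite !exprD.
move: (expf_neq0 i X0) (expf_neq0 d X0).
move: (_ ^+ i) (_ ^+ d) ((1 - s) ^+ i) ((1 - s) ^+ d) (_ ^+ j) (_ ^+ e).
by move=> xi xd yi yd xj xe xi0 xd0; field; apply/andP.
Qed.

Lemma coef_comp_polyNX (R : comNzRingType) (p : {poly R}) i : (p \Po (- 'X))`_i = (-1) ^+ i * p`_i.
Proof.
rewrite coef_comp_poly.
have sg (j : nat) : ((- 'X) ^+ j)`_i = (-1) ^+ j * (i == j)%:R :> R.
  by rewrite -scaleN1r exprZn coefZ coefXn.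
under eq_bigr do rewrite sg.
have [ip|ip] := ltnP i (size p).
  rewrite (bigD1 (Ordinal ip)) //= eqxx mulr1 big1 ?addr0 1?mulrC // => j.
  by rewrite -val_eqE eq_sym => /negPf /= ->; rewrite !mulr0.
rewrite nth_default // mulr0 big1 // => j _.
by have := ltn_ord j; case: eqP => [<-|_ _]; rewrite ?mulr0 // ltnNge ip.
Qed.

Lemma dvdp_Xn_coef (p : {poly rat}) d :
  (forall i, (i < d)%N -> p`_i = 0) -> 'X^d %| p.
Proof.
move=> h; rewrite -[p](poly_take_drop d).
suff -> : take_poly d p = 0 by rewrite add0r dvdp_mull.
by apply/polyP => i; rewrite coef_take_poly coef0; case: ifP => // /h.
Qed.

Lemma size_linear_exp (a b : rat) k : b != 0 ->
  size ((a%:P + b%:P * 'X) ^+ k) = k.+1.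
Proof.
move=> b0; have sz : size (a%:P + b%:P * 'X) = 2%N.
  by rewrite addrC size_MXaddC polyC_eq0 (negPf b0) size_polyC b0.
have nz : (a%:P + b%:P * 'X) ^+ k != 0.
  by rewrite expf_neq0 // -size_poly_eq0 sz.
by rewrite -[LHS]prednK ?size_poly_gt0 // size_exp sz mul1n.
Qed.

(* The involution s |-> (1 - s) / (1 + 3 s) and the parity turn a zero of order d
   at 0 into zeros of order d at 1 and -1; the e missing top coefficients give
   a zero of order e at -1/3. *)
Lemma mac_inv_eq0 N (c : rat) p d e (b : bool) : c != 0 -> mac_inv N c p ->
  (forall i, (i < d)%N -> p`_i = 0) ->
  (forall i, p`_i != 0 -> odd i = b) ->
  (size p + e <= N.+1)%N -> (size p <= 3 * d + e)%N -> p = 0.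
Proof.
move=> c0 inv /dvdp_Xn_coef Xp par sz1 sz2; apply/eqP; apply: contraTT sz2 => p0.
rewrite -ltnNge.
have dv1 := mac_inv_dvdp c0 inv Xp sz1.
have Yp : (1 - 'X) ^+ d %| p by apply: dvdp_trans dv1; rewrite dvdp_mulr.
have Zp : (1 + 'X) ^+ d %| p.
  have : ((1 - 'X) ^+ d) \Po (- 'X) %| p \Po (- 'X) by apply: dvdp_comp_poly.
  have -> : p \Po (- 'X) = (-1) ^+ b *: p.
    apply/polyP => i; rewrite coef_comp_polyNX coefZ -signr_odd.
    by have [->|/par ->] := eqVneq p`_i 0; rewrite ?mulr0.
  rewrite dvdpZr ?signr_eq0 // rmorphXn /=.
  by rewrite comp_polyB comp_polyX comp_polyC opprK.
have Tp : (1 + 3 * 'X) ^+ e %| p by apply: dvdp_trans dv1; rewrite dvdp_mull.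
(* Each pair of linear factors has a Bezout combination equal to a positive integer, a unit over the
   rationals. *)
have cop (a a' u v : {poly rat}) i k l : u * a + v * a' = i.+1%:R ->
    coprimep (a ^+ k) (a' ^+ l).
  move=> h; apply/coprimep_expl/coprimep_expr/Bezout_coprimepP.
  by exists (u, v); rewrite /= h -size_poly_eq1 -polyC_natr size_polyC pnatr_eq0.
have c1 : coprimep ('X^d) ((1 - 'X : {poly rat}) ^+ d) by apply: (cop _ _ 1 1 0%N); ring.
have c2 : coprimep ('X^d) ((1 + 'X : {poly rat}) ^+ d) by apply: (cop _ _ (-1) 1 0%N); ring.
have c3 : coprimep ((1 - 'X) ^+ d) ((1 + 'X : {poly rat}) ^+ d) by apply: (cop _ _ 1 1 1%N); ring.
have c4 : coprimep ('X^d) ((1 + 3 * 'X : {poly rat}) ^+ e) by apply: (cop _ _ (-3) 1 0%N); ring.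
have c5 : coprimep ((1 - 'X) ^+ d) ((1 + 3 * 'X : {poly rat}) ^+ e) by apply: (cop _ _ 3 1 3%N); ring.
have c6 : coprimep ((1 + 'X) ^+ d) ((1 + 3 * 'X : {poly rat}) ^+ e) by apply: (cop _ _ 3 (-1) 1%N); ring.
have : ('X^d * (1 - 'X) ^+ d * (1 + 'X) ^+ d * (1 + 3 * 'X) ^+ e) %| p.
  by rewrite !Gauss_dvdp ?Xp ?Yp ?Zp ?Tp ?coprimepMl ?c1 ?c2 ?c3 ?c4 ?c5 ?c6.
move=> /(dvdp_leq p0); apply: leq_trans.
have szY : size ((1 - 'X : {poly rat}) ^+ d) = d.+1.
  by rewrite -(@size_linear_exp 1 (-1) d) // polyCN polyC1 mulN1r.
have szZ : size ((1 + 'X : {poly rat}) ^+ d) = d.+1.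
  by rewrite -(@size_linear_exp 1 1 d) // polyC1 mul1r.
have szT : size ((1 + 3 * 'X : {poly rat}) ^+ e) = e.+1.
  by rewrite -(@size_linear_exp 1 3 e) // polyC1 polyC_natr.
have nz (q : {poly rat}) k : size q = k.+1 -> q != 0.
  by move=> sq; rewrite -size_poly_eq0 sq.
have szM (q r : {poly rat}) k l : size q = k.+1 -> size r = l.+1 ->
    size (q * r) = (k + l).+1.
  by move=> hq hr; rewrite size_mul ?(nz _ _ hq) ?(nz _ _ hr) // hq hr addnS.
rewrite (szM _ _ _ _ (szM _ _ _ _ (szM _ _ _ _ (size_polyXn _ d) szY) szZ) szT).
by rewrite ltnS !mulSn mul0n addn0 !addnA.
Qed.

(** * The Gleason basis and the congruence modulo 9 *)

Lemma mac_invM N N' c c' p q :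
  mac_inv N c p -> mac_inv N' c' q -> mac_inv (N + N') (c * c') (p * q).
Proof.
by move=> hp hq s s0; rewrite !hornerM exprD mulrACA hp // hq // mulrACA.
Qed.

Lemma mac_invX N c p k : mac_inv N c p -> mac_inv (N * k) (c ^+ k) (p ^+ k).
Proof. by move=> hp s s0; rewrite !horner_exp exprM -!exprMn hp. Qed.

Lemma mac_invBZ N c p q a :
  mac_inv N c p -> mac_inv N c q -> mac_inv N c (p - a *: q).
Proof.
move=> hp hq s s0; rewrite !hornerD !hornerN !hornerZ mulrBr hp // mulrCA hq //.
ring.
Qed.

(* The monomials in the two generators x^2 + 3 y^2 and y^2 (x^2 - y^2)^2 of
   Gleason's invariant ring, at x = 1. *)
Definition gleason_basis (R : comNzRingType) (m j : nat) : {poly R} :=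
  (1 + 3 * 'X^2) ^+ (3 * (m - j)) * ('X^2 * (1 - 'X^2) ^+ 2) ^+ j.

Lemma mac_inv_gleason_basis m j : (j <= m)%N ->
  mac_inv (6 * m) (2 ^+ (6 * m)) (gleason_basis rat m j).
Proof.
move=> jm.
have E1 (u : rat) : (1 + 3 * 'X^2).[u] = 1 + 3 * u ^+ 2.
  by rewrite -(polyC_natr _ 3) -polyC1 mul_polyC !hornerE.
have E2 (u : rat) : ('X^2 * (1 - 'X^2) ^+ 2).[u] = u ^+ 2 * (1 - u ^+ 2) ^+ 2.
  by rewrite -polyC1 hornerM !horner_exp hornerD hornerN horner_exp hornerX hornerC.
have h1 : mac_inv 2 (2 ^+ 2) (1 + 3 * 'X^2).
  by move=> s /mul1D3_neq0 s0; rewrite !E1; field.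
have h2 : mac_inv 6 (2 ^+ 6) ('X^2 * (1 - 'X^2) ^+ 2).
  by move=> s /mul1D3_neq0 s0; rewrite !E2; field.
have := mac_invM (mac_invX (3 * (m - j)) h1) (mac_invX j h2).
have -> : (2 * (3 * (m - j)) + 6 * j = 6 * m)%N by lia.
rewrite -!exprM -exprD; have -> // : (2 * (3 * (m - j)) + 6 * j = 6 * m)%N by lia.
Qed.

Lemma map_gleason_basis m j :
  map_poly intr (gleason_basis int m j) = gleason_basis rat m j.
Proof.
rewrite /gleason_basis -(polyC_natr int 3) -(polyC_natr rat 3) !mul_polyC.
rewrite rmorphM !rmorphXn rmorphM !rmorphXn rmorphB rmorphD /=.
by rewrite !rmorph1 map_polyZ !rmorphXn /= map_polyX.
Qed.

(** Unitriangularity: the lowest term is t^(2j) with coefficient 1, so elimination needs no division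
    and stays over the integers. *)
Lemma coef_gleason_basis m j i : (i <= 2 * j)%N ->
  (gleason_basis int m j)`_i = (i == 2 * j)%N%:R.
Proof.
move=> ij; rewrite /gleason_basis exprMn -exprM mulrCA coefXnM.
case: ltngtP ij => // -> _; rewrite subnn -horner_coef0.
rewrite -polyC1 -(polyC_natr _ 3) mul_polyC !hornerM !horner_exp !hornerD hornerN.
by rewrite hornerZ !hornerXn hornerC expr0n mulr0 oppr0 !addr0 !expr1n mulr1.
Qed.

Lemma gleason_basis_even m j i : odd i -> (gleason_basis int m j)`_i = 0.
Proof.
move=> oi; have : (gleason_basis int m j \Po (- 'X))`_i = (gleason_basis int m j)`_i.
  congr _`_i; rewrite /gleason_basis -(polyC_natr int 3) mul_polyC -polyC1.
  rewrite comp_polyM !rmorphXn /= comp_polyM !rmorphXn /= comp_polyB comp_polyD.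
  by rewrite comp_polyZ !comp_polyC !rmorphXn /= comp_polyX sqrrN.
rewrite coef_comp_polyNX -signr_odd oi expr1 mulN1r; lia.
Qed.

Lemma size_gleason_basis m j : (j <= m)%N -> (size (gleason_basis int m j) <= (6 * m).+1)%N.
Proof.
move=> jm.
have s1 : (size (1 + 3 * 'X^2 : {poly int})%R <= 3)%N.
  rewrite -(polyC_natr _ 3) mul_polyC (leq_trans (size_polyD _ _)) // geq_max.
  by rewrite size_poly1 (leq_trans (size_scale_leq _ _)) // size_polyXn.
have s0 : (size (1 - 'X^2 : {poly int})%R <= 3)%N.
  by rewrite (leq_trans (size_polyD _ _)) // geq_max size_poly1 size_polyN size_polyXn.
have s2 : (size ('X^2 * (1 - 'X^2) ^+ 2 : {poly int})%R <= 7)%N.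
  rewrite (leq_trans (size_polyMleq _ _)) // size_polyXn (leq_add2l 2 _ 5).
  rewrite (leq_trans (size_poly_exp_leq _ _)) // ltnS (leq_mul2r 2 _ 2) /=.
  by rewrite -subn1 leq_subLR.
have expo (p : {poly int}) k l : (size p <= k.+1)%N -> (size (p ^+ l) <= (k * l).+1)%N.
  move=> sp; rewrite (leq_trans (size_poly_exp_leq _ _)) // ltnS leq_mul2r.
  by rewrite -subn1 leq_subLR sp orbT.
apply: (leq_trans (size_polyMleq _ _)).
have := leq_add (expo _ _ (3 * (m - j))%N s1) (expo _ _ j s2).
rewrite addnS -subn1 leq_subLR => /leq_trans; apply; lia.
Qed.

Lemma gleason_basis0_mod9 m :
  exists q, gleason_basis int m 0 = 1 + 9 * q.
Proof.
rewrite /gleason_basis subn0 expr0 mulr1 exprM.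
elim: m => [|m [q IH]]; first by exists 0; rewrite expr0 mulr0 addr0.
(* (1 + 3 t^2)^3 = 1 + 9 u, and (1 + 9 q) (1 + 9 u) is again 1 modulo 9. *)
pose u : {poly int} := 'X^2 + 3 * 'X^4 + 3 * 'X^6.
exists (q + u + 9 * (q * u)); rewrite exprS IH /u.
have -> : 'X^4 = ('X^2) ^+ 2 :> {poly int} by rewrite -exprM.
have -> : 'X^6 = ('X^2) ^+ 3 :> {poly int} by rewrite -exprM.
by move: 'X^2 => x; ring.
Qed.

(* Triangular elimination against the basis keeps every coefficient divisible by 9;
   the final remainder is O(t^(2m+2)), hence zero. *)
Lemma gleason_mod9 m (w : {poly int}) :
  mac_inv (6 * m) (2 ^+ (6 * m)) (map_poly intr w) ->
  (size w <= (6 * m).+1)%N -> (forall i, odd i -> w`_i = 0) ->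
  (forall i, (i <= 2 * m)%N -> exists k, w`_i = (i == 0)%N%:R + 9 * k) ->
  exists q, w = 1 + 9 * q.
Proof.
move=> inv szw ev low.
have [q0 q0E] := gleason_basis0_mod9 m.
have c9 (p : {poly int}) i : (9 * p)`_i = 9 * p`_i.
  by rewrite -(polyC_natr _ 9) coefCM.
(* Loop invariant: after j rounds the remainder vanishes below degree 2j, and only multiples of 9
   have been subtracted besides the basis element of index 0. *)
suff claim j : (j <= m.+1)%N -> exists q : {poly int},
    let r := w - gleason_basis int m 0 - 9 * q in
    [/\ mac_inv (6 * m) (2 ^+ (6 * m)) (map_poly intr r),
        (size r <= (6 * m).+1)%N, forall i, odd i -> r`_i = 0 &
        forall i, (i < 2 * j)%N -> r`_i = 0].
  have [q [/= ri rs re r0]] := claim m.+1 (leqnn _).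
  exists (q0 + q); set r := w - _ - _ in ri rs re r0.
  suff r00 : r = 0.
    by move/eqP: r00; rewrite /r q0E subr_eq0 subr_eq => /eqP ->; ring.
  have injm : injective (map_poly (intr : int -> rat)).
    by apply: map_inj_poly => //; apply: intr_inj.
  apply: injm; rewrite rmorph0.
  have szr : size (map_poly intr r : {poly rat}) = size r.
    by apply: size_map_inj_poly => //; apply: intr_inj.
  (* The order of vanishing d = 2m+2 suffices with e = 0, since 6m+1 <= 3 (2m+2). *)
  apply: (@mac_inv_eq0 (6 * m) (2 ^+ (6 * m)) _ (2 * m.+1) 0 false) => //.
  - by rewrite expf_neq0.
  - by move=> i /r0 h; rewrite coef_map h.
  - by move=> i; rewrite coef_map intr_eq0; apply: contraNF => /re ->.
  - by rewrite szr addn0.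
  - by rewrite szr addn0 (leq_trans rs) //; lia.
elim: j => [_|j IH jm].
  exists 0 => /=; rewrite mulr0 subr0; split => //.
  - rewrite rmorphB /= map_gleason_basis -[X in _ - X]scale1r.
    by apply: mac_invBZ => //; apply: mac_inv_gleason_basis.
  - rewrite (leq_trans (size_polyD _ _)) // geq_max szw size_polyN.
    exact: size_gleason_basis.
  - by move=> i oi; rewrite coefB ev // gleason_basis_even // subr0.
have [q [/= ri rs re r0]] := IH (ltnW jm); set r := w - _ - _ in ri rs re r0.
(* Both [w] and the basis element of index 0 have the coefficients of 1 modulo 9 in this range, so
   they cancel modulo 9. *)
have [k kE] : exists k, r`_(2 * j) = 9 * k.
  have [k kE] := low (2 * j)%N ltac:(lia).
  exists (k - q0`_(2 * j) - q`_(2 * j)).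
  by rewrite /r !coefB q0E coefD coef1 !c9 kE; ring.
have rE : w - gleason_basis int m 0 - 9 * (q + k%:P * gleason_basis int m j)
    = r - (9 * k) *: gleason_basis int m j.
  by rewrite /r -mul_polyC polyCM polyC_natr; ring.
exists (q + k%:P * gleason_basis int m j) => /=; rewrite rE; split.
- rewrite rmorphB /= map_polyZ map_gleason_basis.
  by apply: mac_invBZ => //; apply: mac_inv_gleason_basis.
- rewrite (leq_trans (size_polyD _ _)) // geq_max rs size_polyN.
  by rewrite (leq_trans (size_scale_leq _ _)) // size_gleason_basis.
- by move=> i oi; rewrite coefB coefZ re // gleason_basis_even // mulr0 subr0.
- move=> i hi; rewrite coefB coefZ.
  case: (ltngtP i (2 * j)) => ij.
  + by rewrite r0 // coef_gleason_basis 1?ltnW // ltn_eqF // mulr0 subr0.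
  (* The only index strictly between 2j and 2j+2 is odd, where parity gives zero. *)
  + have oi : odd i by (have -> : i = (2 * j).+1 by lia); rewrite /= oddM.
    by rewrite re // gleason_basis_even // mulr0 subr0.
  + by rewrite ij kE coef_gleason_basis // eqxx mulr1 subrr.
Qed.

(** * Weight enumerators of Hermitian self-dual codes *)

Lemma wt_le (F : finFieldType) n (x : 'rV[F]_n) : (wt x <= n)%N.
Proof. by rewrite -[n in (_ <= n)%N]card_ord max_card. Qed.

Lemma wt_eq0 (F : finFieldType) n (x : 'rV[F]_n) : (wt x == 0)%N = (x == 0).
Proof.
rewrite cards_eq0; apply/eqP/eqP => [h|->].
  apply/rowP => k; rewrite mxE; apply/eqP; apply: contraT => xk.
  by have := in_set0 k; rewrite -h inE xk.
by apply/setP => k; rewrite !inE mxE eqxx.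
Qed.

Lemma wtZ (F : finFieldType) n (a : F) (x : 'rV[F]_n) : a != 0 -> wt (a *: x) = wt x.
Proof.
by move=> a0; apply: eq_card => k; rewrite !inE mxE mulf_eq0 (negPf a0).
Qed.

(** A nonzero coordinate contributes a^3 = 1 to the product of x with itself, so this product, which
    is 0, is the weight modulo 2. *)
Lemma self_dual_wt_even (F : finFieldType) n (D : {vspace 'rV[F]_n}) (x : 'rV[F]_n) :
  #|F| = 4%N -> herm_self_dual D -> x \in D -> ~~ odd (wt x).
Proof.
move=> F4 sd xD; rewrite -dvdn2 (dvdn_pcharf (pchar2_card4 F4)).
rewrite -((sd x).1 xD x xD) /herm_ip /wt -sum1_card natr_sum.
rewrite [X in X == _]big_mkcond /=; apply/eqP/eq_bigr => k _.
rewrite inE; case: eqP => [->|/eqP xk] /=; first by rewrite mul0r.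
by apply: (mulfI xk); rewrite mulr1 -exprS -exprS -F4 expf_card.
Qed.

Definition supp (F : finFieldType) n (x : 'rV[F]_n) : {set 'I_n} :=
  [set k | x ord0 k != 0].

(** Taking a = 1, b = s gives the monomial of x; taking a = 1 + 3s, b = (1-s)/(1+3s) gives its
    MacWilliams transform. The set A is either everything or all coordinates but one. *)
Lemma prod_supp (F : finFieldType) n (x : 'rV[F]_n) (A : {set 'I_n}) (a b : rat) :
  \prod_(k in A) (if x ord0 k == 0 then a else a * b)
  = a ^+ #|A| * b ^+ #|A :&: supp x|.
Proof.
have -> : b ^+ #|A :&: supp x| = \prod_(k in A | x ord0 k != 0) b.
  by rewrite -prodr_const; apply: eq_bigl => k; rewrite !inE.
rewrite -prodr_const big_mkcondr -big_split /=; apply: eq_bigr => k _.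
by case: ifP => _ /=; rewrite ?mulr1.
Qed.

Lemma card_supp_setC1 (F : finFieldType) n (x : 'rV[F]_n) (k : 'I_n) :
  #|[set~ k] :&: supp x| = (wt x - (x ord0 k != 0%R))%N.
Proof. by rewrite /wt -/(supp x) (cardsD1 k (supp x)) inE addKn setIC -setDE. Qed.

Definition wt_enum (F : finFieldType) n (D : {vspace 'rV[F]_n}) : {poly int} :=
  \sum_(c in D) 'X^(wt c).

(** The weight enumerator of D shortened at k; adding [nonzero_enum], whose exponents drop
    coordinate k, gives that of D punctured at k. *)
Definition zero_enum (F : finFieldType) n (D : {vspace 'rV[F]_n}) (k : 'I_n) : {poly rat} :=
  \sum_(c in D | c ord0 k == 0) 'X^(wt c).

Definition nonzero_enum (F : finFieldType) n (D : {vspace 'rV[F]_n}) (k : 'I_n) : {poly rat} :=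
  \sum_(c in D | c ord0 k != 0) 'X^((wt c).-1).

Lemma map_wt_enum (F : finFieldType) n (D : {vspace 'rV[F]_n}) :
  map_poly intr (wt_enum D) = \sum_(c in D) 'X^(wt c) :> {poly rat}.
Proof. by rewrite rmorph_sum; apply: eq_bigr => c _ /=; rewrite map_polyXn. Qed.

Lemma macwilliams (F : finFieldType) n (D : {vspace 'rV[F]_n}) :
  #|F| = 4%N -> herm_self_dual D ->
  mac_inv n #|D|%:R (map_poly intr (wt_enum D)).
Proof.
move=> F4 sd s s0; have X0 := mul1D3_neq0 s0.
rewrite map_wt_enum !horner_sum.
have := poisson (fun _ a => if a == 0 then 1 else s) F4 sd.
have -> : \sum_(v in D) \prod_k (if v ord0 k == 0 then 1 else s)
        = \sum_(v in D) ('X^(wt v)).[s].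
  apply: eq_bigr => v _; have := prod_supp v setT 1 s.
  by rewrite mul1r expr1n mul1r setTI hornerXn => <-; apply: eq_bigl => k; rewrite inE.
move=> <-; rewrite mulr_sumr; apply: eq_bigr => c _.
under [RHS]eq_bigr do rewrite fourier_weight //.
have := prod_supp c setT (1 + 3 * s) ((1 - s) / (1 + 3 * s)).
rewrite (mulrC (1 + 3 * s)) divfK // cardsT card_ord setTI hornerXn => <-.
by apply: eq_bigl => k; rewrite inE.
Qed.

(** MacWilliams identity between the punctured and the shortened code, both of length n - 1. It is
    Poisson summation with the indicator of 0 at coordinate k, whose transform is constantly 1. *)
Lemma macwilliams_coord (F : finFieldType) n (D : {vspace 'rV[F]_n}) (k : 'I_n) (s : rat) :
  #|F| = 4%N -> herm_self_dual D -> 0 < s ->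
  (1 + 3 * s) ^+ n.-1 * (zero_enum D k + nonzero_enum D k).[(1 - s) / (1 + 3 * s)]
  = #|D|%:R * (zero_enum D k).[s].
Proof.
move=> F4 sd s0; have X0 := mul1D3_neq0 s0.
pose f (j : 'I_n) (a : F) : rat :=
  if j == k then (a == 0)%:R else if a == 0 then 1 else s.
have := poisson f F4 sd.
have split_k (g : 'I_n -> rat) : \prod_j g j = g k * \prod_(j in [set~ k]) g j.
  by rewrite (bigD1 k) //=; congr (_ * _); apply: eq_bigl => j; rewrite !inE.
have -> : \sum_(v in D) \prod_j f j (v ord0 j) = (zero_enum D k).[s].
  rewrite horner_sum [RHS]big_mkcondr /=; apply: eq_bigr => v _.
  rewrite split_k {1}/f eqxx.
  case: ifPn => vk; rewrite ?mul0r // mul1r hornerXn.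
  have := prod_supp v [set~ k] 1 s.
  rewrite mul1r expr1n mul1r card_supp_setC1 vk subn0 => <-.
  by apply: eq_bigr => j; rewrite !inE /f => /negPf ->.
move=> <-.
have -> : zero_enum D k + nonzero_enum D k
    = \sum_(c in D) 'X^(wt c - (c ord0 k != 0)).
  rewrite [RHS](bigID (fun c : 'rV[F]_n => c ord0 k == 0)) /=; congr (_ + _).
    by apply: eq_bigr => c /andP [_ ->]; rewrite subn0.
  by apply: eq_bigr => c /andP [_ ->]; rewrite subn1.
rewrite horner_sum mulr_sumr; apply: eq_bigr => c _.
rewrite [RHS]split_k {1}/f eqxx fourier_delta mul1r hornerXn.
have := prod_supp c [set~ k] (1 + 3 * s) ((1 - s) / (1 + 3 * s)).
rewrite (mulrC (1 + 3 * s)) divfK // cardsC1 card_ord card_supp_setC1 => <-.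
apply: eq_bigr => j; rewrite !inE /f => /negPf jk.
by under [RHS]eq_bigr do rewrite jk; rewrite fourier_weight.
Qed.

Lemma zeroD_nonzero_enum (F : finFieldType) n (D : {vspace 'rV[F]_n}) (k : 'I_n) :
  zero_enum D k + 'X * nonzero_enum D k = map_poly intr (wt_enum D).
Proof.
rewrite map_wt_enum [RHS](bigID (fun c : 'rV[F]_n => c ord0 k == 0)) /=.
congr (_ + _); rewrite mulr_sumr; apply: eq_bigr => c /andP [_ ck].
by rewrite -exprS prednK // /wt card_gt0; apply/set0Pn; exists k; rewrite inE.
Qed.

(** The full enumerator does not depend on the coordinate, so the [zero_enum] difference is -t Z.
    Subtracting the two coordinate identities gives a factor 1 - u on the left and -s on the right;
    as (1 + 3s)(1 - u) = 4s, cancelling it lowers the degree to n - 2 and divides the constant by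
    4. *)
Lemma mac_inv_nonzero_enumB (F : finFieldType) n (D : {vspace 'rV[F]_n}) (k l : 'I_n) :
  #|F| = 4%N -> herm_self_dual D -> (1 < n)%N ->
  mac_inv (n - 2) (- (#|D|%:R / 4)) (nonzero_enum D k - nonzero_enum D l).
Proof.
move=> F4 sd n1 s s0; have X0 := mul1D3_neq0 s0.
set Z := _ - _; set u := (1 - s) / (1 + 3 * s).
have dz : zero_enum D k - zero_enum D l = - ('X * Z).
  have zE i : zero_enum D i = map_poly intr (wt_enum D) - 'X * nonzero_enum D i.
    by rewrite -(zeroD_nonzero_enum D i) addrK.
  have aux (M x a b : {poly rat}) : M - x * a - (M - x * b) = - (x * (a - b)) by ring.
  by rewrite !zE aux.
have := macwilliams_coord k F4 sd s0; have := macwilliams_coord l F4 sd s0.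
rewrite -/u => hl hk.
have : (1 + 3 * s) ^+ n.-1 * (zero_enum D k - zero_enum D l + Z).[u]
    = #|D|%:R * (zero_enum D k - zero_enum D l).[s].
  rewrite [in RHS]hornerD hornerN mulrBr -hk -hl -mulrBr -hornerN -hornerD /Z.
  by congr (_ * _.[_]); ring.
rewrite dz; clearbody Z; rewrite !(hornerD, hornerN, hornerM, hornerX).
have -> : n.-1 = (n - 2).+1 by lia.
rewrite exprS.
have us : (1 + 3 * s) * u = 1 - s by rewrite /u mulrC divfK.
move: (_ ^+ (n - 2)) (Z.[u]) (Z.[s]) (#|D|%:R) => x zu zs d h.
have s4 : 4 * s != 0 by rewrite mulf_neq0 // lt0r_neq0.
suff : 4 * s * (x * zu) = 4 * s * (- (d / 4) * zs) by move/(mulfI s4).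
have key : 4 * s * (x * zu) = (1 + 3 * s - (1 + 3 * s) * u) * x * zu by rewrite us; ring.
have key' : 4 * s * (- (d / 4) * zs) = d * - (s * zs) by field.
by rewrite key key' -h; ring.
Qed.

(** * Counting codewords by weight and coordinate *)

Lemma coef_wt_enum (F : finFieldType) n (D : {vspace 'rV[F]_n}) i :
  (wt_enum D)`_i = (weight_count D i)%:R.
Proof.
rewrite coef_sum /weight_count -sum1_card natr_sum big_mkcond [RHS]big_mkcond.
apply: eq_bigr => c _; rewrite inE coefXn eq_sym.
by case: (c \in D); case: (_ == _).
Qed.

Definition coord_count (F : finFieldType) n (D : {vspace 'rV[F]_n}) (k : 'I_n) (j : nat) : nat :=
  #|[set c : 'rV[F]_n | [&& c \in D, wt c == j & c ord0 k != 0]]|.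

Lemma coef_nonzero_enum (F : finFieldType) n (D : {vspace 'rV[F]_n}) (k : 'I_n) i :
  (nonzero_enum D k)`_i = (coord_count D k i.+1)%:R.
Proof.
rewrite coef_sum /coord_count -sum1_card natr_sum big_mkcond [RHS]big_mkcond.
apply: eq_bigr => c _; rewrite inE coefXn.
case: (c \in D) => //=; case: ifPn => ck; rewrite ?andbF // andbT.
have wc : (0 < wt c)%N by apply/card_gt0P; exists k; rewrite inE.
by rewrite -(eqn_add2r 1) addn1 addn1 prednK // eq_sym; case: (_ == _).
Qed.

(* The nonzero scalars permute the codewords of each weight, and exactly one
   scalar multiple of a word has k-th coordinate 1. *)
Lemma dvd3_coord_count (F : finFieldType) n (D : {vspace 'rV[F]_n}) (k : 'I_n) j :
  #|F| = 4%N -> (3 %| coord_count D k j)%N.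
Proof.
move=> F4; pose S a := [set c : 'rV[F]_n | [&& c \in D, wt c == j & c ord0 k == a]].
have SE a : a != 0 -> #|S a| = #|S 1|.
  move=> a0; have inj : injective ( *:%R a : 'rV[F]_n -> 'rV[F]_n) by apply: scalerI.
  rewrite -[RHS](card_imset _ inj); apply: eq_card => c; apply/idP/imsetP => [|[d]].
    rewrite inE => /and3P [cD wc ck]; exists (a^-1 *: c); last by rewrite scalerA divff ?scale1r.
    by rewrite inE memvZ // wtZ ?invr_eq0 // wc mxE (eqP ck) mulVf /=.
  rewrite inE => /and3P [dD wd dk] ->.
  by rewrite inE memvZ // wtZ // wd mxE (eqP dk) mulr1 /=.
have -> : coord_count D k j = (\sum_(a | a != 0%R) #|S a|)%N.
  rewrite /coord_count -sum1_card (partition_big (fun c : 'rV[F]_n => c ord0 k) (fun a => a != 0)) /=.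
    apply: eq_bigr => a a0; rewrite -sum1_card; apply: eq_bigl => c.
    by rewrite !inE; case: (_ =P a) => [->|]; rewrite ?a0 ?andbT ?andbF.
  by move=> c; rewrite inE => /and3P [].
rewrite (eq_bigr (fun=> #|S 1|)) // sum_nat_const.
have -> : #|[pred a : F | a != 0]| = 3%N.
  by transitivity #|predC1 (0 : F)|; [apply: eq_card | rewrite cardC1 F4].
by rewrite dvdn_mulr.
Qed.

(** Double counting of the pairs of a codeword of weight j and a coordinate in its support. *)
Lemma sum_coord_count (F : finFieldType) n (D : {vspace 'rV[F]_n}) j :
  (\sum_k coord_count D k j = j * weight_count D j)%N.
Proof.
rewrite /coord_count; under eq_bigr do rewrite -sum1_card big_mkcond.
rewrite exchange_big /= /weight_count mulnC -sum_nat_const [RHS]big_mkcond.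
apply: eq_bigr => c _; rewrite inE.
case: ifP => [/andP [cD /eqP <-]|h].
  rewrite [in RHS]/wt -[RHS]sum1_card [RHS]big_mkcond; apply: eq_bigr => k _.
  by rewrite !inE cD eqxx.
by rewrite big1 // => k _; rewrite inE andbA h.
Qed.

Lemma weight_count0 (F : finFieldType) n (D : {vspace 'rV[F]_n}) :
  weight_count D 0 = 1%N.
Proof.
transitivity #|[set (0 : 'rV[F]_n)]|; last by rewrite cards1.
by apply: eq_card => c; rewrite !inE wt_eq0; case: eqP => [->|]; rewrite ?mem0v ?andbF.
Qed.

(** The MacWilliams identity at s = 1 reads 4^n W(0) = |D| W(1), where W(0) = 1 and W(1) = |D|. *)
Lemma card_self_dual (F : finFieldType) n (D : {vspace 'rV[F]_n}) :
  #|F| = 4%N -> herm_self_dual D -> #|D| = (2 ^ n)%N.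
Proof.
move=> F4 sd; have := macwilliams F4 sd (ltr01 : 0 < 1 :> rat).
rewrite subrr mul0r horner_coef0 coef_map coef_wt_enum map_wt_enum horner_sum.
rewrite weight_count0.
under eq_bigr do rewrite hornerXn expr1n.
rewrite sumr_const rmorph1 !mulr1 => h; apply/eqP; rewrite -(eqn_exp2r _ _ (isT : 0 < 2)%N).
rewrite -(eqr_nat rat) !natrX -exprM mulnC exprM.
by rewrite [X in _ == X ^+ _](_ : _ = 1 + 3) // h expr2.
Qed.

(** * Near-extremal codes *)

(* The codewords of each weight hold a 1-design. The difference has parity 1, a
   zero of order 2m-1 at 0 and, as the words of full weight cancel and odd weights
   do not occur, size at most 6m-2. *)
Lemma near_extremal_design (F : finFieldType) m (D : {vspace 'rV[F]_(6 * m)})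
    (k l : 'I_(6 * m)) :
  #|F| = 4%N -> (0 < m)%N -> near_extremal D ->
  nonzero_enum D k = nonzero_enum D l.
Proof.
move=> F4 m0 [sd [_ minw]]; rewrite mulKn // in minw.
have m61 : (1 < 6 * m)%N by lia.
have inv := mac_inv_nonzero_enumB k l F4 sd m61.
have D0 : (#|D|%:R : rat) != 0 by rewrite (card_self_dual F4 sd) pnatr_eq0 expn_eq0.
have even_out i : ~~ odd i -> forall k, coord_count D k i.+1 = 0%N.
  move=> oi k'; apply/eqP; rewrite cards_eq0; apply/eqP/setP => c; rewrite !inE.
  apply/negP => /and3P [cD /eqP wc _].
  by have := self_dual_wt_even F4 sd cD; rewrite wc /= oi.
have low_out i : (i < 2 * m - 1)%N -> forall k, coord_count D k i.+1 = 0%N.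
  move=> hi k'; apply/eqP; rewrite cards_eq0; apply/eqP/setP => c; rewrite !inE.
  apply/negP => /and3P [cD /eqP wc ck].
  have c0 : c != 0 by apply: contraNneq ck => ->; rewrite mxE.
  by have := minw c cD c0; rewrite wc; lia.
(* Here the weight i+1 is at least 6m-1 and even, hence 6m, and a word of full weight is nonzero at
   both k and l. *)
have top i : (6 * m - 2 <= i)%N -> coord_count D k i.+1 = coord_count D l i.+1.
  move=> hi; apply: eq_card => c; rewrite !inE.
  case cD: (c \in D) => //=; case: eqP => //= wc.
  have we := self_dual_wt_even F4 sd cD; have wl := wt_le c.
  have full : [set j | c ord0 j != 0] = setT.
    by apply/eqP; rewrite eqEcard subsetT cardsT card_ord -/(wt c); lia.
  by have := in_setT k; have := in_setT l; rewrite -full !inE => -> ->.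
apply/eqP; rewrite -subr_eq0; apply/eqP.
have sz : (size (nonzero_enum D k - nonzero_enum D l)%R <= 6 * m - 2)%N.
  by apply/leq_sizeP => i hi; rewrite coefB !coef_nonzero_enum top // subrr.
(* The bounds are tight: 6m-2 = 3 (2m-1) + 1, and e = 1 accounts for the missing coefficient of
   degree 6m-2. *)
apply: (@mac_inv_eq0 _ _ _ (2 * m - 1) 1 true _ inv).
- by rewrite oppr_eq0 mulf_neq0.
- by move=> i hi; rewrite coefB !coef_nonzero_enum !low_out // subrr.
- move=> i; rewrite coefB !coef_nonzero_enum; apply: contraNeq => oi.
  by rewrite !even_out ?subrr //; case: (odd i) oi.
- by rewrite addn1; apply: (leq_ltn_trans sz); lia.
- by apply: (leq_trans sz); lia.
Qed.

Lemma near_extremal_min_count (F : finFieldType) m (D : {vspace 'rV[F]_(6 * m)}) :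
  #|F| = 4%N -> (0 < m)%N -> near_extremal D -> (9 %| weight_count D (2 * m))%N.
Proof.
move=> F4 m0 ne; have m60 : (0 < 6 * m)%N by lia.
pose k0 : 'I_(6 * m) := Ordinal m60.
have cc k : coord_count D k (2 * m) = coord_count D k0 (2 * m).
  have := congr1 (fun p : {poly rat} => p`_(2 * m).-1) (near_extremal_design k k0 F4 m0 ne).
  rewrite /= !coef_nonzero_enum prednK; last by lia.
  by move/eqP; rewrite eqr_nat => /eqP.
have := sum_coord_count D (2 * m).
rewrite (eq_bigr _ (fun k _ => cc k)) sum_nat_const card_ord => h.
(* The incidence count says 6m B = 2m A, so A = 3 B after cancelling 2m. *)
have -> : weight_count D (2 * m) = (3 * coord_count D k0 (2 * m))%N.
  by apply/eqP; rewrite -(eqn_pmul2l (isT : 0 < 2)%N) -(eqn_pmul2l m0); apply/eqP; lia.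
by rewrite (@dvdn_pmul2l 3 3) // dvd3_coord_count.
Qed.

Lemma near_extremal_enum_mod9 (F : finFieldType) m (D : {vspace 'rV[F]_(6 * m)}) :
  #|F| = 4%N -> (0 < m)%N -> near_extremal D -> exists q, wt_enum D = 1 + 9 * q.
Proof.
move=> F4 m0 ne; have [sd [_ minw]] := ne; rewrite mulKn // in minw.
apply: (@gleason_mod9 m).
- have := macwilliams F4 sd; rewrite (card_self_dual F4 sd) natrX; exact.
- apply/leq_sizeP => i hi; rewrite coef_wt_enum.
  suff -> : weight_count D i = 0%N by [].
  apply/eqP; rewrite cards_eq0; apply/eqP/setP => c; rewrite !inE.
  by apply/negP => /andP [_ /eqP wc]; have := wt_le c; lia.
- move=> i oi; rewrite coef_wt_enum.
  suff -> : weight_count D i = 0%N by [].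
  apply/eqP; rewrite cards_eq0; apply/eqP/setP => c; rewrite !inE.
  apply/negP => /andP [cD /eqP wc].
  by have := self_dual_wt_even F4 sd cD; rewrite wc oi.
- move=> i hi; rewrite coef_wt_enum.
  have [->|i0] := eqVneq i 0%N.
    by exists 0; rewrite weight_count0.
  have [->|im] := eqVneq i (2 * m)%N.
    have /dvdnP [q ->] := near_extremal_min_count F4 m0 ne.
    by exists q%:R; rewrite natrM mulrC /= add0r.
  exists 0; suff -> : weight_count D i = 0%N by rewrite mulr0.
  apply/eqP; rewrite cards_eq0; apply/eqP/setP => c; rewrite !inE.
  apply/negP => /andP [cD /eqP wc].
  have c0 : c != 0 by rewrite -wt_eq0 wc.
  by have := minw c cD c0; lia.
Qed.

Local Close Scope ring_scope.

Theorem theorem3p5 (F : finFieldType) (m : nat) (D : {vspace 'rV[F]_(6 * m)}) :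
  #|F| = 4 -> (0 < m)%N -> near_extremal D ->
  forall i : nat, (m <= i <= 3 * m)%N -> weight_count D (2 * i) %% 9 = 0.
Proof.
move=> F4 m0 ne i /andP [mi _].
have [q qE] := near_extremal_enum_mod9 F4 m0 ne.
have := coef_wt_enum D (2 * i).
rewrite qE coefD coef1 -(polyC_natr _ 9) coefCM.
(* The constant 1 only reaches the coefficient of index 0, and 2i > 0 because i >= m > 0. *)
case: eqP => [|_]; first by lia.
by lia.
Qed.
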